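(* Let $\bar h\ge0$, let $a_{ij}:[0,\infty)\to[0,\infty)$ be locally Lebesgue integrable and $h_{ij}:[0,\infty)\to[0,\bar h]$ Lebesgue measurable. Suppose that the undisturbed algorithm $$\dot x_i(t)=\sum_{j\in\mathcal V,\ j\ne i}a_{ij}(t)\bigl(x_j(t-h_{ij}(t))-x_i(t)\bigr),\qquad i\in\mathcal V,$$ establishes consensus between two agents $i$ and $j$. Then the same holds for the disturbed algorithm $$\dot x_m(t)=\sum_{l\in\mathcal V,\ l\ne m}a_{ml}(t)\bigl(x_l(t-h_{ml}(t))-x_m(t)\bigr)+f_m(t),\qquad m\in\mathcal V,$$ with any $L_1$-summable disturbance, i.e., $\int_0^\infty|f_m(t)|\,dt<\infty$ for all $m\in\mathcal V$.
   Context: $\mathcal V$ is a finite nonempty set. For a starting time $t_*\ge0$, the initial condition prescribes $x(t_* )\in\mathbb R^{\mathcal V}$ and $x(t_*+s)=\varphi(s)$ for $s\in[-\bar h,0)$ with $\varphi$ bounded Borel; the solution is locally absolutely continuous on $[t_*,\infty)$ and satisfies the equation for almost all $t\ge t_*$. An algorithm establishes consensus between agents $i$ and $j$ if for every $t_*\ge0$ and every initial condition the limits $\lim_{t\to\infty}x_i(t)$ and $\lim_{t\to\infty}x_j(t)$ exist and coincide. *)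

(* Defs.v *)
From mathcomp Require Import all_boot all_order all_algebra.
From mathcomp Require Import all_classical all_reals all_analysis.
Import Order.TTheory GRing.Theory Num.Theory.
Import numFieldNormedType.Exports.

Set Implicit Arguments.
Unset Strict Implicit.
Unset Printing Implicit Defensive.

Local Open Scope classical_set_scope.
Local Open Scope ring_scope.

(* The canonical sigma-algebra on [R] is the Borel one. [lebesgueType R] is the
   same carrier with the (complete) sigma-algebra of Lebesgue-measurable sets,
   on which [completed_lebesgue_measure] is defined. *)
Definition lebesgueType (R : realType) :=
  caratheodory_type (@wlength R idfun)^*%mu.

Definition lebesgue_measurable_fun (R : realType) (D : set R) (f : R -> R) :=
  measurable_fun (D : set (lebesgueType R)) (f : lebesgueType R -> R).

Definition lebesgue_integrable (R : realType) (D : set R) (f : R -> R) : Prop :=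
  (@completed_lebesgue_measure R).-integrable D (EFin \o f).

(* The library's [locally_integrable] requires an open domain, hence a separate
   definition for the closed half-line [0, +oo[. *)
Definition locally_lebesgue_integrable (R : realType) (f : R -> R) :=
  forall T : R, 0 <= T -> lebesgue_integrable `[0, T] f.

Definition absolutely_continuous_on (R : realType) (a b : R) (f : R -> R) :=
  forall e : R, 0 < e -> exists2 d : R, 0 < d &
    forall (n : nat) (u v : 'I_n -> R),
      (forall k, [/\ a <= u k, u k <= v k & v k <= b]) ->
      trivIset [set: 'I_n] (fun k => `]u k, v k[%classic) ->
      \sum_(k < n) (v k - u k) < d ->
      \sum_(k < n) `|f (v k) - f (u k)| < e.

Definition locally_absolutely_continuous_from
    (R : realType) (a : R) (f : R -> R) :=
  forall b : R, a <= b -> absolutely_continuous_on a b f.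

(* A trajectory is [x : V -> R -> R], with [x m t] the value of agent [m] at
   time [t]. Only its values on [ts - hbar, +oo[ matter. *)
Definition consensus_rhs (R : realType) (V : finType) (a h : V -> V -> R -> R)
    (x : V -> R -> R) (m : V) (t : R) : R :=
  \sum_(l | l != m) a m l t * (x l (t - h m l t) - x m t).

Definition bounded_borel_history (R : realType) (V : finType) (hbar : R)
    (phi : V -> R -> R) :=
  forall m, measurable_fun `[- hbar, 0[ (phi m) /\
            [bounded phi m s | s in `[- hbar, 0[].

(* [F] maps a whole trajectory to the right-hand side, since the latter depends
   on delayed values. *)
Record is_solution (R : realType) (V : finType) (hbar : R)
    (F : (V -> R -> R) -> V -> R -> R)
    (ts : R) (x0 : V -> R) (phi : V -> R -> R) (x : V -> R -> R) : Prop :=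
  IsSolution {
    solution_init : forall m, x m ts = x0 m ;
    solution_history : forall m s, - hbar <= s < 0 -> x m (ts + s) = phi m s ;
    solution_ac : forall m, locally_absolutely_continuous_from ts (x m) ;
    solution_ode : forall m, {ae @lebesgue_measure R, forall t : R,
      ts <= t -> is_derive t 1 (x m) (F x m t)}
  }.

Definition establishes_consensus (R : realType) (V : finType) (hbar : R)
    (F : (V -> R -> R) -> V -> R -> R) (i j : V) :=
  forall (ts : R) (x0 : V -> R) (phi : V -> R -> R) (x : V -> R -> R),
    0 <= ts -> bounded_borel_history hbar phi ->
    is_solution hbar F ts x0 phi x ->
    exists c : R, x i t @[t --> +oo] --> c /\ x j t @[t --> +oo] --> c.

(* Main.v *)
Require Import Defs.
From mathcomp Require Import all_boot all_order all_algebra.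
From mathcomp Require Import all_classical all_reals all_analysis.
From mathcomp Require Import measurable_realfun ring lra.
Import Order.TTheory GRing.Theory Num.Theory.
Import numFieldNormedType.Exports.

Set Implicit Arguments.
Unset Strict Implicit.
Unset Printing Implicit Defensive.

Local Open Scope classical_set_scope.
Local Open Scope ring_scope.

(** The disturbed trajectory [x] is compared with undisturbed ones. At a late
time [s], let [y] be the solution of the undisturbed system whose history on
[[s - hbar, s]] is that of [x]. The difference [x - y] vanishes up to time [s]
and solves the system with disturbance [f]; since each agent only moves towards
values of the others, this difference never exceeds the integral of [|f|] from
[s] on ([comparison]). By assumption [y i] and [y j] tend to a common limit, so
[x i] and [x j] are eventually within [e] of one number, where [e] is as small
as desired when [s] is late. Hence [x i] satisfies the Cauchy criterion and
[x j] has the same limit.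

Two facts carry the argument. The undisturbed system has a solution for every
bounded Borel history ([delay_system_solution]); otherwise the assumption would
say nothing about the restarted system. After multiplication by the integrating
factor [ifactor], the variation of constants formula is a monotone operator
that preserves bounds, so its iterates from a constant upper bound decrease to
a fixed point by dominated convergence. Second, the comparison bound is
obtained by bootstrapping ([one_sided_bound]): a bound [B] on the excess of
[x - y] over the integral of the disturbance, valid for all agents up to a time
[T], improves to [q * B] for some [q < 1] depending on [T] only, and therefore
the excess is nonpositive.

Both facts pass from derivatives to increments through [ac_ge0_derive_le]: an
absolutely continuous function whose derivative is nonnegative almost everywhere
is nondecreasing. In the other direction, Lebesgue's differentiation theorem
gives the derivative of a primitive. As the weights and delays are only Lebesgue
measurable, they are first replaced by Borel functions equal to them almost
everywhere ([lebesgue_borel_version]), which changes neither the solutions nor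
the integrals. *)

(** * Monotonicity of absolutely continuous functions *)

(** Compactness of the segment in the form of Cousin's lemma: a property of
intervals that holds on all small intervals around each point and passes to
unions of adjacent intervals holds on the whole segment. The supremum of the
right ends that can be reached from [a] is reached, and cannot lie below [b]. *)
Lemma cousin (R : realType) (Q : R -> R -> Prop) (a b : R) :
    a <= b ->
    (forall u w v, a <= u -> u <= w -> w <= v -> v <= b ->
       Q u w -> Q w v -> Q u v) ->
    (forall c, a <= c <= b -> exists2 d, 0 < d & forall u v,
       a <= u -> u <= c -> c <= v -> v <= b -> c - d < u -> v < c + d ->
       Q u v) ->
  Q a b.
Proof.
move=> ab Qtrans Qloc.
pose S := [set t | a <= t <= b /\ Q a t].
have Sa : S a.
  split; first by rewrite lexx.
  have [|d d0] := Qloc a; first by rewrite lexx.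
  by apply; rewrite ?lexx//; lra.
have Sub : ubound S b by move=> t [/andP[]].
have hS : has_sup S by split; [exists a | exists b].
have ac : a <= sup S by apply: ub_le_sup => //; exists b.
have cb : sup S <= b by apply: ge_sup => //; exists a.
have [|d d0 Qd] := Qloc (sup S); first by rewrite ac.
have [t [/andP[at_ tb] Qat] tS] := sup_adherent d0 hS.
have tc : t <= sup S.
  by apply: ub_le_sup => //; [exists b|split; [rewrite at_|]].
pose v := Num.min b (sup S + d / 2).
have vb : v <= b by rewrite ge_min lexx.
have cv : sup S <= v by rewrite le_min cb/=; lra.
have Sv : S v.
  split; first by rewrite vb andbT; lra.
  apply: (Qtrans a t v) => //; first lra.
  by apply: Qd => //; rewrite gt_min; apply/orP; right; lra.
have vc : v <= sup S by apply: ub_le_sup => //; exists b.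
have : v = b.
  by move: vc; rewrite /v; case: (leP b) => // _; lra.
by move=> <-; exact: Sv.2.
Qed.

(** The interval may straddle [c]: adding the one-sided estimates on [[u, c]]
and [[c, v]] gives the form needed to glue neighbourhoods together. *)
Lemma is_derive_ge0_local (R : realType) (f : R -> R) (c df e : R) :
    is_derive c 1 f df -> 0 <= df -> 0 < e ->
  exists2 d, 0 < d & forall u v, u <= c -> c <= v -> c - d < u -> v < c + d ->
    - (e * (v - u)) <= f v - f u.
Proof.
move=> [fc fE] df0 e0.
have : h^-1 *: ((f \o shift c) (h *: (1 : R)) - f c) @[h --> 0^'] --> df.
  by move: fc => /cvg_ex[l fl]; rewrite -fE /derive; rewrite (cvg_lim _ fl).
move=> /cvgrPdist_lt/(_ _ e0); rewrite near_withinE => /nbhs_ballP[d d0 /= H].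
exists d => //.
have K v : `|v - c| < d -> v != c -> - e < (v - c)^-1 * (f v - f c).
  move=> vc vNc; have := H (v - c).
  rewrite /ball/= sub0r normrN => /(_ vc); rewrite subr_eq0 => /(_ vNc).
  rewrite /GRing.scale /= mulr1 subrK ltr_norml => /andP[_]; lra.
have right_ v : c <= v -> v < c + d -> - (e * (v - c)) <= f v - f c.
  rewrite le_eqVlt => /orP[/eqP <- _|cv vd].
    by rewrite !subrr mulr0 oppr0.
  have vc : 0 < v - c by rewrite subr_gt0.
  have := K v; rewrite gtr0_norm // => /(_ ltac:(lra)).
  rewrite gt_eqF // => /(_ isT).
  rewrite -(ltr_pM2l vc) mulrA mulfV ?gt_eqF// mul1r; lra.
have left_ u : u <= c -> c - d < u -> - (e * (c - u)) <= f c - f u.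
  rewrite le_eqVlt => /orP[/eqP -> _|uc ud].
    by rewrite !subrr mulr0 oppr0.
  have cu : u - c < 0 by rewrite subr_lt0.
  have := K u; rewrite ltr0_norm // => /(_ ltac:(lra)).
  rewrite lt_eqF // => /(_ isT).
  rewrite -(ltr_nM2l cu) mulrA mulfV ?lt_eqF// mul1r; lra.
move=> u v uc cv ud vd; have := right_ v cv vd; have := left_ u uc ud; lra.
Qed.

Section ac_monotone.
Context {R : realType}.
Notation mu := (@lebesgue_measure R).

(** A finite family of non-overlapping intervals in [U], listed from left to
right so that families over adjacent segments are concatenated. *)
Let system (U : set R) (a b : R) (s : seq (R * R)) :=
  (forall p, p \in s -> [/\ a <= p.1, p.1 <= p.2, p.2 <= b &
     `]p.1, p.2[%classic `<=` U]) /\ pairwise (fun p q => p.2 <= q.1) s.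

Let variation (f : R -> R) (s : seq (R * R)) :=
  \sum_(p <- s) `|f p.2 - f p.1|.

Let p0 : R * R := (0, 0).

Let system_trivIset (s : seq (R * R)) :
  pairwise (fun p q => p.2 <= q.1) s ->
  trivIset [set: 'I_(size s)]
    (fun k => `](nth p0 s k).1, (nth p0 s k).2[%classic).
Proof.
move=> /(pairwiseP p0) ps; apply/trivIsetP => i j _ _ ij.
apply/seteqP; split => // t []/=; rewrite !in_itv/=.
move=> /andP[ti it] /andP[tj jt].
move: ij; rewrite neq_ltn => /orP[] ij.
- by have := ps i j (ltn_ord i) (ltn_ord j) ij; lra.
- by have := ps j i (ltn_ord j) (ltn_ord i) ij; lra.
Qed.

Let system_size (U : set R) a b s (d : R) : measurable U -> (mu U < d%:E)%E ->
  system U a b s -> \sum_(p <- s) (p.2 - p.1) < d.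
Proof.
move=> mU Ud [sU ps]; rewrite -lte_fin; apply: le_lt_trans Ud.
rewrite (big_nth p0) big_mkord.
have H := system_trivIset ps.
have sU' (k : 'I_(size s)) := sU _ (mem_nth p0 (ltn_ord k)).
have -> : (\sum_(i < size s) ((nth p0 s i).2 - (nth p0 s i).1))%:E =
   (\sum_(i < size s) mu `](nth p0 s i).1, (nth p0 s i).2[%classic)%E.
  rewrite -sumEFin; apply: eq_bigr => i _.
  have [_ + _ _] := sU' i.
  rewrite lebesgue_measure_itv/= lte_fin le_eqVlt => /orP[/eqP ->|->].
    by rewrite ltxx subrr.
  by rewrite EFinB.
rewrite -measure_bigsetU_ord//.
apply: le_measure; rewrite ?inE//.
  exact: bigsetU_measurable.
elim/big_ind : _ => //= [A B AU BU t [/AU|/BU]//|k _].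
by have [_ _ _] := sU' k.
Qed.

(** Cover the null set where the derivative is not known to be nonnegative by an
open set [U] so small that [f] varies by less than [e] over any family of
intervals in [U]. Around a point outside this null set [f] decreases by at most
[e] times the length of the interval, and around a point of it the interval
lies in [U]; Cousin's lemma assembles these local bounds into
[f b - f a >= - e * (b - a) - e]. *)
Lemma ac_ge0_derive_le (f : R -> R) (a b : R) : a <= b ->
    absolutely_continuous_on a b f ->
    {ae mu, forall t, a < t < b -> exists2 df, is_derive t 1 f df & 0 <= df} ->
  f a <= f b.
Proof.
move=> ab fac [N [mN N0 NE]]; apply/ler_addgt0Pl => e0 e0_gt0.
pose e := e0 / (b - a + 1).
have ba1 : 0 < b - a + 1 by lra.
have e_gt0 : 0 < e by rewrite divr_gt0.
have e0E : e0 = e * (b - a) + e.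
  by rewrite -[X in _ + X]mulr1 -mulrDr divfK ?gt_eqF.
have [d d_gt0 fd] := fac e e_gt0.
(* Nothing is known of the derivative at the end points, so they are covered
   along with the exceptional set. *)
pose N' := N `|` ([set a] `|` [set b]).
have mN' : measurable N' by do 2?apply: measurableU.
have N'0 : mu N' = 0%E.
  apply/eqP; rewrite eq_le measure_ge0 andbT.
  apply: (le_trans (measureU2 _ _ _)) => //; first exact: measurableU.
  rewrite [X in (X + _)%E]N0 add0e.
  apply: (le_trans (measureU2 _ _ _)) => //.
  have mu1 x : mu [set x] = 0%E := lebesgue_measure_set1 x.
  by rewrite [X in (X + _)%E]mu1 [X in (_ + X)%E]mu1 adde0.
have [|U [oU N'U Ud]] := @lebesgue_regularity_outer _ N' d mN' _ d_gt0.
  by rewrite [X in (X < _)%E]N'0 ltry.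
have mU : measurable U by exact: open_measurable.
have {}Ud : (mu U < d%:E)%E.
  rewrite -(setDUK N'U); apply: (le_lt_trans (measureU2 _ _ _)) => //.
    exact: measurableD.
  by rewrite [X in (X + _)%E]N'0 add0e.
have [s [sU svar]] : exists s, system U a b s /\
    - (e * (b - a)) - variation f s <= f b - f a.
  apply: (@cousin _ (fun u v => exists s, system U u v s /\
    - (e * (v - u)) - variation f s <= f v - f u)) => //.
  - move=> u w v _ uw wv _ [s1 [[s1U s1p] s1v]] [s2 [[s2U s2p] s2v]].
    exists (s1 ++ s2); split; last first.
      rewrite /variation big_cat/= -/(variation f s1) -/(variation f s2); lra.
    split=> [p|].
      rewrite mem_cat => /orP[/s1U[? ? ? ?]|/s2U[? ? ? ?]]; split => //; lra.
    rewrite pairwise_cat s1p s2p !andbT; apply/allrelP => p q.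
    by move=> /s1U[? ? ? ?] /s2U[? ? ? ?]; lra.
  - move=> c /andP[ac cb]; have [cN'|cN'] := pselect (N' c).
      have /nbhs_ballP[r r0 rU] : nbhs c U.
        by apply: open_nbhs_nbhs; split => //; exact: N'U.
      exists r => // u v au uc cv vb cu vc; exists [:: (u, v)]; split.
        split=> // p; rewrite inE => /eqP ->/=; split => //; first lra.
        move=> t; rewrite /= in_itv/= => /andP[ut tv]; apply: rU.
        by rewrite /ball/= ltr_distlC; apply/andP; split; lra.
      rewrite /variation big_seq1/=.
      have := ler_norm (- (f v - f u)); rewrite normrN.
      have : 0 <= e * (v - u) by rewrite mulr_ge0 ?(ltW e_gt0)//; lra.
      lra.
    have [df dfc df0] : exists2 df, is_derive c 1 f df & 0 <= df.
      apply: contrapT => H; apply: (cN'); left; apply: NE => /= K; apply: H.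
      apply: K; rewrite !lt_neqAle ac cb !andbT; apply/andP; split.
        by apply/eqP => acE; apply: (cN'); right; left.
      by apply/eqP => acE; apply: (cN'); right; right.
    have [r r0 H] := is_derive_ge0_local dfc df0 e_gt0.
    exists r => // u v au uc cv vb cu vc; exists [::]; split; first by split.
    by rewrite /variation big_nil subr0; exact: H.
have fs : variation f s < e.
  rewrite /variation (big_nth p0) big_mkord.
  apply: (fd _ (fun k => (nth p0 s k).1) (fun k => (nth p0 s k).2)).
  - move=> k; have [] := sU.1 _ (mem_nth p0 (ltn_ord k)) => *; split; lra.
  - exact: (system_trivIset sU.2).
  - by have := system_size mU Ud sU; rewrite (big_nth p0) big_mkord.
lra.
Qed.
End ac_monotone.

(** * Operations on absolutely continuous functions *)

Section ac_algebra.
Context {R : realType}.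
Implicit Types (f g : R -> R) (a b : R).

Lemma ac_uniformly_continuous f a b : absolutely_continuous_on a b f ->
  forall e, 0 < e -> exists2 d, 0 < d & forall u v,
    a <= u <= b -> a <= v <= b -> `|v - u| < d -> `|f v - f u| < e.
Proof.
move=> fac e /fac[d d0 fd]; exists d => //.
have H u v : u <= v -> a <= u <= b -> a <= v <= b -> `|v - u| < d ->
    `|f v - f u| < e.
  move=> uv /andP[au ub] /andP[av vb]; rewrite ger0_norm ?subr_ge0// => uvd.
  have := fd 1 (fun=> u) (fun=> v); rewrite !big_ord1; apply => //.
  by apply/trivIsetP => i j _ _; rewrite !ord1 eqxx.
move=> u v abu abv uvd; have [/H|/ltW/H Hvu] := leP u v; first exact.
by rewrite distrC; apply: Hvu => //; rewrite distrC.
Qed.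

Lemma ac_bounded f a b : a <= b -> absolutely_continuous_on a b f ->
  exists M, forall t, a <= t <= b -> `|f t| <= M.
Proof.
move=> ab fac; have [d d0 fd] := ac_uniformly_continuous fac ltr01.
apply: (@cousin _ (fun u v => exists M, forall t, u <= t <= v -> `|f t| <= M))
    => //.
- move=> u w v _ uw wv _ [M1 H1] [M2 H2]; exists (Num.max M1 M2) => t.
  move=> /andP[ut tv]; rewrite le_max.
  by have [tw|/ltW wt] := leP t w; [rewrite H1 ?ut|rewrite H2 ?orbT ?wt].
- move=> c acb; exists d => // u v au uc cv vb cu vc.
  exists (`|f c| + 1) => t /andP[ut tv].
  have : `|f t - f c| < 1.
    apply: fd => //; first by apply/andP; split; lra.
    by rewrite ltr_norml; apply/andP; split; lra.
  have := ler_normD (f t - f c) (f c); rewrite subrK; lra.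
Qed.

(** Sums, products and exponentials all reduce to this: their increments are
controlled by those of their arguments, which are bounded on the segment. *)
Lemma ac_dominated f g (h : R -> R) a b (C : R) :
    absolutely_continuous_on a b f -> absolutely_continuous_on a b g ->
    (forall u v, a <= u -> u <= v -> v <= b ->
       `|h v - h u| <= C * (`|f v - f u| + `|g v - g u|)) ->
  absolutely_continuous_on a b h.
Proof.
move=> fac gac hfg e e0.
pose C' := Num.max C 1.
have C'1 : 1 <= C' by rewrite le_max lexx orbT.
have C'0 : 0 < C' by lra.
have e'0 : 0 < e / (C' * 2) by rewrite divr_gt0// mulr_gt0.
have [d1 d10 fd] := fac _ e'0; have [d2 d20 gd] := gac _ e'0.
exists (Num.min d1 d2); first by rewrite lt_min d10.
move=> n u v uv tuv.
rewrite lt_min => /andP[/(fd _ _ _ uv tuv) fe /(gd _ _ _ uv tuv) ge].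
apply: (@le_lt_trans _ _
  (\sum_(k < n) C' * (`|f (v k) - f (u k)| + `|g (v k) - g (u k)|))).
  apply: ler_sum => k _; have [au uvk vb] := uv k.
  apply: (le_trans (hfg _ _ au uvk vb)).
  by apply: ler_wpM2r; [exact: addr_ge0|rewrite le_max lexx].
rewrite -mulr_sumr big_split/=.
have -> : e = C' * (e / (C' * 2) + e / (C' * 2)) by field; rewrite gt_eqF.
by rewrite ltr_pM2l// ltrD.
Qed.

Lemma acD f g a b :
    absolutely_continuous_on a b f -> absolutely_continuous_on a b g ->
  absolutely_continuous_on a b (fun t => f t + g t).
Proof.
move=> fac gac; apply: (@ac_dominated f g _ a b 1) => // u v _ _ _.
by rewrite mul1r (le_trans _ (ler_normD _ _))// opprD addrACA.
Qed.

Lemma ac_cst c a b : absolutely_continuous_on a b (fun=> c).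
Proof.
move=> e e0; exists 1 => // n u v _ _ _.
by rewrite big1// => k _; rewrite subrr normr0.
Qed.

Lemma acM f g a b : a <= b ->
    absolutely_continuous_on a b f -> absolutely_continuous_on a b g ->
  absolutely_continuous_on a b (fun t => f t * g t).
Proof.
move=> ab fac gac; have [M fM] := ac_bounded ab fac.
have [N gN] := ac_bounded ab gac.
apply: (@ac_dominated f g _ a b (Num.max M N)) => // u v au uv vb.
have -> : f v * g v - f u * g u = f v * (g v - g u) + g u * (f v - f u) by ring.
rewrite (le_trans (ler_normD _ _))// [leRHS]mulrDr [leRHS]addrC !normrM.
by rewrite lerD// ler_wpM2r// le_max ?fM ?gN ?orbT//; apply/andP; split; lra.
Qed.

Lemma acN f a b : absolutely_continuous_on a b f ->
  absolutely_continuous_on a b (fun t => - f t).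
Proof.
move=> fac; apply: (@ac_dominated f f _ a b 1) => // u v _ _ _.
by rewrite mul1r -opprD normrN lerDl.
Qed.

Lemma acB f g a b :
    absolutely_continuous_on a b f -> absolutely_continuous_on a b g ->
  absolutely_continuous_on a b (fun t => f t - g t).
Proof. by move=> fac /acN; exact: acD. Qed.

Lemma expR_increment (x y M : R) : x <= M -> y <= M ->
  `|expR y - expR x| <= expR M * `|y - x|.
Proof.
wlog xy : x y / x <= y.
  move=> H xM yM; have [xy|/ltW yx] := leP x y; first exact: H.
  by rewrite distrC [`|y - x|]distrC H.
move=> xM yM; rewrite !ger0_norm ?subr_ge0 ?ler_expR//.
have -> : expR y - expR x = expR y * (1 - expR (x - y)).
  by rewrite mulrBr mulr1 -expRD addrCA subrr addr0.
apply: ler_pM; [exact: expR_ge0| |by rewrite ler_expR|].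
  by rewrite subr_ge0 -expR0 ler_expR; lra.
have := expR_ge1Dx (x - y); lra.
Qed.

Lemma ac_expR f a b : a <= b -> absolutely_continuous_on a b f ->
  absolutely_continuous_on a b (fun t => expR (f t)).
Proof.
move=> ab fac; have [M fM] := ac_bounded ab fac.
apply: (@ac_dominated f f _ a b (expR M)) => // u v au uv vb.
apply: (le_trans (@expR_increment _ _ M _ _)).
- by apply: (le_trans (ler_norm _)); apply: fM; apply/andP; split; lra.
- by apply: (le_trans (ler_norm _)); apply: fM; apply/andP; split; lra.
- by rewrite ler_wpM2l ?expR_ge0// lerDl.
Qed.

Lemma ac_sub f a b c d : c <= a -> b <= d -> absolutely_continuous_on c d f ->
  absolutely_continuous_on a b f.
Proof.
move=> ca bd fac e /fac[r r0 fr]; exists r => // n u v uv.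
by apply: fr => k; have [? ? ?] := uv k; split; lra.
Qed.

Lemma eq_ac f g a b : (forall t, a <= t <= b -> f t = g t) ->
  absolutely_continuous_on a b f -> absolutely_continuous_on a b g.
Proof.
move=> fg fac; apply: (@ac_dominated f f _ a b 1) => // u v au uv vb.
by rewrite !fg ?mul1r ?lerDl//; apply/andP; split; lra.
Qed.

End ac_algebra.

(** * Primitives of locally integrable functions *)

Section primitive.
Context {R : realType}.
Notation mu := (@lebesgue_measure R).
Implicit Types (f g : R -> R).

(** Data on the half-line of times are extended by zero to negative times, which
makes them integrable up to [-oo] and spares primitives a base point. *)
Definition left_integrable g :=
  forall b : R, mu.-integrable `]-oo, b] (EFin \o g).

Definition prim g (t : R) : R := (\int[mu]_(x in `]-oo, t]) g x)%R.

Lemma primE g t : prim g t = (\int[mu]_(x in `]-oo, t]) g x)%R.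
Proof. by []. Qed.

Lemma left_integrable_measurable g :
  left_integrable g -> measurable_fun setT g.
Proof.
move=> ig; have -> : [set: R] = \bigcup_n `]-oo, n%:R]%classic.
  apply/esym/seteqP; split => // x _.
  exists (Num.truncn `|x|).+1 => //=; rewrite in_itv/= ltW//.
  by rewrite (le_lt_trans (ler_norm x))// truncnS_gt.
apply/measurable_fun_bigcup => // n.
by apply/measurable_EFinP; have /integrableP[] := ig n%:R.
Qed.

Lemma left_integrable_itv g u v : left_integrable g ->
  mu.-integrable `]u, v] (EFin \o g).
Proof.
move=> ig; apply: integrableS (ig v) => //.
by move=> x /=; rewrite !in_itv/= => /andP[].
Qed.

Lemma left_integrable_dominated g f : left_integrable g ->
    measurable_fun setT f ->
    (forall b, exists C, forall t, t <= b -> `|f t| <= C * `|g t|) ->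
  left_integrable f.
Proof.
move=> ig mf fg b; have [C fC] := fg b.
have := @integrableZl _ _ _ mu `]-oo, b]%classic
  ltac:(exact: measurable_itv) C _ (ig b).
apply: le_integrable => //.
  by apply/measurable_EFinP; exact: measurable_funTS.
move=> x /=; rewrite in_itv/= => xb.
by rewrite lee_fin (le_trans (fC _ xb))// normrM ler_wpM2r// ler_norm.
Qed.

Lemma left_integrable_sum (I : finType) (P : pred I) (g : I -> R -> R) :
  (forall i, left_integrable (g i)) ->
  left_integrable (fun t => \sum_(i | P i) g i t).
Proof.
move=> ig b.
have := @integrable_sum _ _ _ mu `]-oo, b]%classic
  ltac:(exact: measurable_itv) I (index_enum I) P
  (fun i => EFin \o g i) (fun i _ => ig i b).
by apply: eq_integrable => // x _ /=; rewrite sumEFin.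
Qed.

Lemma left_integrable_norm g :
  left_integrable g -> left_integrable (fun t => `|g t|).
Proof.
move=> ig; apply: (left_integrable_dominated ig).
  by apply: measurableT_comp => //; exact: left_integrable_measurable.
by move=> b; exists 1 => t _; rewrite mul1r normr_id.
Qed.

Lemma primB g u v : left_integrable g -> u <= v ->
  prim g v - prim g u = (\int[mu]_(x in `]u, v]) g x)%R.
Proof. by move=> ig uv; rewrite /prim Rintegral_itvB// bnd_simp. Qed.

Lemma prim_le f g u v : left_integrable f -> left_integrable g -> u <= v ->
    (forall t, u < t <= v -> f t <= g t) ->
  prim f v - prim f u <= prim g v - prim g u.
Proof.
move=> iF ig uv fg; rewrite !primB//; apply: le_Rintegral => //.
- exact: left_integrable_itv.
- exact: left_integrable_itv.
Qed.

(** Lebesgue's differentiation theorem. *)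
Lemma is_derive_prim g : left_integrable g ->
  {ae mu, forall t : R, is_derive t 1 (prim g) (g t)}.
Proof.
move=> ig.
have lg : locally_integrable [set: R] g.
  split; [exact: left_integrable_measurable|exact: openT|move=> K _ cK].
  have [M [_ HM]] := compact_bounded cK.
  have KM : K `<=` `]-oo, M + 1].
    move=> x /HM; rewrite /= in_itv/= => /(_ (M + 1)).
    by move=> /(_ ltac:(lra)); apply: le_trans; exact: ler_norm.
  have /integrableP[mg goo] := ig (M + 1).
  apply: le_lt_trans goo; apply: ge0_subset_integral => //.
    exact: compact_measurable.
  by apply/measurable_EFinP/measurableT_comp => //; exact/measurable_EFinP.
have := FTC1Ny ig lg.
apply: filterS; first exact: (ae_filter_ringOfSetsType mu).
move=> t [dt E]; apply: DeriveDef => //.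
by rewrite -derive1E.
Qed.

(** Absolute continuity of the integral with respect to the measure, applied to
the union of the intervals on which increments are taken. *)
Lemma ac_prim g a b : left_integrable g ->
  absolutely_continuous_on a b (prim g).
Proof.
move=> ig e e0.
pose gb := g \_ `]-oo, b].
have igb : mu.-integrable setT (EFin \o gb).
  rewrite (_ : EFin \o gb = (EFin \o g) \_ `]-oo, b]); last first.
    by rewrite restrict_EFin.
  by apply/integrable_restrict => //; rewrite setTI.
have [d [d0 Hd]] := integral_normr_continuous igb e0.
exists d => // n u v uv tuv uvd.
pose F (k : 'I_n) := `]u k, v k[%classic.
have mF k : measurable (F k) by exact: measurable_itv.
have mA : measurable (\big[setU/set0]_(k < n) F k) by exact: bigsetU_measurable.
have mgb : measurable_fun setT (fun x => `|gb x|%:E).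
  by apply/measurable_EFinP/measurableT_comp => //;
    have /integrableP[/measurable_EFinP] := igb.
have igF k : mu.-integrable (F k) (fun x => `|gb x|%:E).
  by apply: integrableS (integrable_norm igb) => //; exact: mF.
have /Hd : (mu (\big[setU/set0]_(k < n) F k) < d%:E)%E.
  rewrite measure_bigsetU_ord; [|by move=> k; exact: mF|exact: tuv].
  move: uvd; rewrite -lte_fin -sumEFin.
  apply: le_lt_trans; apply: lee_sum => k _ /=; have [_ + _] := uv k.
  rewrite lebesgue_measure_itv/= lte_fin le_eqVlt => /orP[/eqP ->|->].
    by rewrite ltxx subrr.
  by rewrite EFinB.
move=> /(_ mA); apply: le_lt_trans.
rewrite /Rintegral ge0_integral_bigsetU//=; last 3 first.
- exact: index_enum_uniq.
- exact: sub_trivIset tuv.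
- exact: measurable_funTS.
rewrite (eq_bigr (fun k => (\int[mu]_(x in F k) `|gb x|)%R%:E)); last first.
  move=> k _; rewrite /Rintegral fineK//.
  by apply: (integrable_fin_num _ (igF k)); exact: mF.
rewrite sumEFin/=.
apply: ler_sum => k _; have [au uvk vb] := uv k.
rewrite primB//; apply: (le_trans (le_normr_Rintegral _ _)) => //.
  exact: left_integrable_itv.
rewrite -Rintegral_itv_bndo_bndc; last first.
  have ing := left_integrable_itv (u k) (v k) (left_integrable_norm ig).
  apply: integrableS ing => //.
  by move=> x /=; rewrite !in_itv/= => /andP[-> /ltW].
rewrite le_eqVlt; apply/orP; left; apply/eqP.
apply: eq_Rintegral => x; rewrite inE/= in_itv/= => /andP[ux xv].
by rewrite /gb patchE mem_set//= in_itv/= (le_trans (ltW xv)).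
Qed.

End primitive.

Section primitive_more.
Context {R : realType}.
Notation mu := (@lebesgue_measure R).
Implicit Types (f g : R -> R).

Lemma continuous_prim g : left_integrable g -> continuous (prim g).
Proof.
move=> ig t; apply/cvgrPdist_lt => e e0.
have [d d0 H] := ac_uniformly_continuous (ac_prim (t - 1) (t + 1) ig) e0.
exists (Num.min d 1) => /=; first by rewrite lt_min d0 ltr01.
move=> u /=; rewrite lt_min => /andP[ud]; rewrite ltr_norml => /andP[u1 u2].
by apply: H => //; apply/andP; split; lra.
Qed.

Lemma measurable_prim g : left_integrable g -> measurable_fun setT (prim g).
Proof. by move=> /continuous_prim; exact: continuous_measurable_fun. Qed.

Lemma prim_dominated_cvg (g_ : nat -> R -> R) g G t :
    (forall n, measurable_fun setT (g_ n)) -> measurable_fun setT g ->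
    left_integrable G -> (forall n x, `|g_ n x| <= G x) ->
    (forall x, g_ n x @[n --> \oo] --> g x) ->
  prim (g_ n) t @[n --> \oo] --> prim g t.
Proof.
move=> mg_ mg iG g_G g_g.
have [||||||ig _ gc] := @dominated_convergence _ _ _ mu `]-oo, t]%classic
  _ (fun n => EFin \o g_ n) (EFin \o g) (EFin \o G).
- exact: measurable_itv.
- by move=> n; apply/measurable_EFinP; apply: measurable_funTS; exact: mg_.
- by apply/measurable_EFinP; apply: measurable_funTS; exact: mg.
- by apply/aeW => x _; apply: (@cvg_comp _ _ _ (g_^~ x) EFin _ _ _ (g_g x)).
- exact: iG.
- by apply/aeW => x n _; rewrite lee_fin.
apply: fine_cvg; rewrite fineK//.
exact: integrable_fin_num.
Qed.

End primitive_more.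

(** * Almost everywhere differential calculus *)

Section ae_glue.
Context {R : realType}.
Notation mu := (@lebesgue_measure R).
Implicit Types P Q S : R -> Prop.

Lemma ae_imply P Q : (forall t, P t -> Q t) ->
  {ae mu, forall t, P t} -> {ae mu, forall t, Q t}.
Proof.
move=> PQ; apply: filterS; last exact: PQ.
exact: (ae_filter_ringOfSetsType mu).
Qed.

Lemma ae_imply2 P Q S : (forall t, P t -> Q t -> S t) ->
  {ae mu, forall t, P t} -> {ae mu, forall t, Q t} -> {ae mu, forall t, S t}.
Proof.
move=> PQS; apply: filterS2; last exact: PQS.
exact: (ae_filter_ringOfSetsType mu).
Qed.

End ae_glue.

Section derive_glue.
Context {R : realType}.
Implicit Types (f g : R -> R) (t : R).

Lemma is_derive_mul f g t df dg :
  is_derive t 1 f df -> is_derive t 1 g dg ->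
  is_derive t 1 (fun t => f t * g t) (f t * dg + g t * df).
Proof. move=> hf hg; exact: is_deriveM. Qed.

Lemma is_derive_scale c f t df :
  is_derive t 1 f df -> is_derive t 1 (fun t => c * f t) (c * df).
Proof.
move=> hf; have := is_derive_mul (is_derive_cst c t 1) hf.
by rewrite mulr0 addr0.
Qed.

Lemma is_derive_add f g t df dg :
  is_derive t 1 f df -> is_derive t 1 g dg ->
  is_derive t 1 (fun t => f t + g t) (df + dg).
Proof. move=> hf hg; exact: is_deriveD. Qed.

Lemma is_derive_sub f g t df dg :
  is_derive t 1 f df -> is_derive t 1 g dg ->
  is_derive t 1 (fun t => f t - g t) (df - dg).
Proof. move=> hf hg; exact: is_deriveB. Qed.

Lemma is_derive_opp f t df :
  is_derive t 1 f df -> is_derive t 1 (fun t => - f t) (- df).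
Proof. move=> hf; exact: is_deriveN. Qed.

Lemma is_derive_exp f t df :
  is_derive t 1 f df -> is_derive t 1 (fun t => expR (f t)) (expR (f t) * df).
Proof. move=> hf; exact: is_derive1_comp. Qed.

End derive_glue.

(** * Integrating factors *)

Section integrating_factor.
Context {R : realType} {V : finType}.
Notation mu := (@lebesgue_measure R).
Variables (a : V -> V -> R -> R).
Hypothesis a_ge0 : forall k l t, 0 <= a k l t.
Hypothesis a_int : forall k l, left_integrable (a k l).

(** The coefficient of [- x m t] in the equation of agent [m]. *)
Definition damping (m : V) (t : R) : R := \sum_(l | l != m) a m l t.

(** Multiplying the equation of agent [m] by this factor absorbs the term
[- damping m t * x m t] into a derivative, and leaves on the right-hand side a
nonnegative combination of delayed values: the system becomes monotone. *)
Definition ifactor m t := expR (prim (damping m) t).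

Lemma damping_int m : left_integrable (damping m).
Proof. exact: left_integrable_sum. Qed.

Lemma damping_ge0 m t : 0 <= damping m t.
Proof. exact: sumr_ge0. Qed.

Lemma ifactor_gt0 m t : 0 < ifactor m t. Proof. exact: expR_gt0. Qed.

Lemma ifactorV m t : (ifactor m t)^-1 = expR (- prim (damping m) t).
Proof. by rewrite expRN. Qed.

Lemma ifactor_meas m : measurable_fun setT (ifactor m).
Proof.
apply: measurableT_comp => //; apply: measurable_prim.
exact: damping_int.
Qed.

Lemma ifactorV_meas m : measurable_fun setT (fun t => (ifactor m t)^-1).
Proof.
rewrite (funext (ifactorV m)); apply: measurableT_comp => //.
by apply: measurableT_comp => //; apply: measurable_prim; exact: damping_int.
Qed.

Lemma ifactor_ac m b c : b <= c -> absolutely_continuous_on b c (ifactor m).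
Proof.
by move=> bc; apply: ac_expR => //; apply: ac_prim; exact: damping_int.
Qed.

Lemma ifactorV_ac m b c : b <= c ->
  absolutely_continuous_on b c (fun t => (ifactor m t)^-1).
Proof.
move=> bc; rewrite (funext (ifactorV m)).
by apply: ac_expR => //; apply: acN; apply: ac_prim; exact: damping_int.
Qed.

Lemma ifactor_nd m b c : b <= c -> ifactor m b <= ifactor m c.
Proof.
move=> bc; rewrite ler_expR -subr_ge0 primB//; last exact: damping_int.
by apply: Rintegral_ge0 => t _; exact: damping_ge0.
Qed.

Lemma ifactor_derive m :
  {ae mu, forall t : R, is_derive t 1 (ifactor m) (ifactor m t * damping m t)}.
Proof.
apply: ae_imply (is_derive_prim (damping_int m)) => t.
exact: is_derive_exp.
Qed.

Lemma ifactorV_derive m :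
  {ae mu, forall t : R, is_derive t 1 (fun t => (ifactor m t)^-1)
     (- ((ifactor m t)^-1 * damping m t))}.
Proof.
apply: ae_imply (is_derive_prim (damping_int m)) => t dA.
rewrite ifactorV (funext (ifactorV m)) -mulrN.
exact: is_derive_exp (is_derive_opp dA).
Qed.

End integrating_factor.

Opaque prim ifactor.

(** * Existence of solutions of the undisturbed system *)

Section existence.
Context {R : realType} {V : finType}.
Notation mu := (@lebesgue_measure R).
Variables (a h : V -> V -> R -> R) (s : R) (x : V -> R -> R) (M : R).
Hypothesis a_ge0 : forall k l t, 0 <= a k l t.
Hypothesis a_int : forall k l, left_integrable (a k l).
Hypothesis h_meas : forall k l, measurable_fun setT (h k l).
Hypothesis x_meas : forall m, measurable_fun setT (x m).
Hypothesis x_le : forall m t, `|x m t| <= M.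

Notation alpha := (damping a).
Notation E := (ifactor a).

Let alpha_int := damping_int a_int.
Let alpha_ge0 := damping_ge0 a_ge0.
Let E_gt0 := ifactor_gt0 a.
Let E_meas := ifactor_meas a_int.

Let Ealpha_int m : left_integrable (fun t => E m t * alpha m t).
Proof.
apply: (left_integrable_dominated (alpha_int m)).
  apply: measurable_funM; first exact: E_meas.
  exact: left_integrable_measurable.
move=> b; exists (E m b) => t tb; rewrite normrM ler_wpM2r//.
by rewrite (gtr0_norm (E_gt0 m t)) ifactor_nd.
Qed.

(** [M * E] dominates: it is the solution obtained when every delayed value is
equal to [M], so that [M * E m - prim g] and [M * E m + prim g] have a
nonnegative derivative. *)
Let prim_le_ifactor m (g : R -> R) u v : u <= v -> left_integrable g ->
    (forall t, `|g t| <= M * (E m t * alpha m t)) ->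
  `|prim g v - prim g u| <= M * (E m v - E m u).
Proof.
move=> uv ig gE.
have up (c : R) : `|c| = 1 ->
    M * E m u - c * prim g u <= M * E m v - c * prim g v.
  move=> c1.
  apply: (@ac_ge0_derive_le _ (fun t => M * E m t - c * prim g t)) => //.
    apply: acB; apply: acM => //;
      [exact: ac_cst|exact: ifactor_ac|exact: ac_cst|exact: ac_prim].
  apply: ae_imply2 (ifactor_derive a_int m) (is_derive_prim ig).
  move=> t dE dk _; exists (M * (E m t * alpha m t) - c * g t).
    exact: is_derive_sub (is_derive_scale M dE) (is_derive_scale c dk).
  rewrite subr_ge0 (le_trans _ (gE t))// (le_trans (ler_norm _))//.
  by rewrite normrM c1 mul1r.
have := up 1 (normr1 _); have := up (-1) ltac:(by rewrite normrN1).
rewrite ler_norml !mul1r !mulN1r mulrBr.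
move: (E m u) (E m v) (prim g u) (prim g v) => Eu Ev gu gv.
move: (M * Eu) (M * Ev) => MEu MEv H1 H2.
by apply/andP; split; lra.
Qed.

Let admissible (y : V -> R -> R) :=
  forall m, measurable_fun setT (y m) /\ forall t, `|y m t| <= M.

Let inflow (y : V -> R -> R) m t :=
  E m t * \sum_(l | l != m) a m l t * y l (t - h m l t).

Let inflow_meas y m : admissible y -> measurable_fun setT (inflow y m).
Proof.
move=> ady; apply: measurable_funM => //.
have -> : (fun t => \sum_(l | l != m) a m l t * y l (t - h m l t)) =
    (fun t => \sum_l (if l != m then a m l t * y l (t - h m l t) else 0)).
  by apply/funext => t; rewrite big_mkcond.
apply: measurable_sum => l; case: (l != m) => //.
apply: measurable_funM; first exact: left_integrable_measurable.
by apply: measurableT_comp; [exact: (ady l).1|exact: measurable_funB].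
Qed.

Let inflow_le y m t : admissible y ->
  `|inflow y m t| <= M * (E m t * alpha m t).
Proof.
move=> ady; rewrite /inflow normrM (gtr0_norm (E_gt0 m t)) [leRHS]mulrCA.
rewrite (ler_wpM2l (ltW (E_gt0 m t)))// /damping mulr_sumr.
rewrite (le_trans (ler_norm_sum _ _ _))//.
apply: ler_sum => l _; rewrite normrM ger0_norm// mulrC.
by apply: ler_wpM2r => //; exact: (ady l).2.
Qed.

Let inflow_int y m : admissible y -> left_integrable (inflow y m).
Proof.
move=> ady; apply: (left_integrable_dominated (Ealpha_int m)).
  exact: inflow_meas.
move=> b; exists M => t _; rewrite (le_trans (inflow_le _ _ ady))//.
by rewrite (ger0_norm (mulr_ge0 (ltW (E_gt0 m t)) (alpha_ge0 m t))).
Qed.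

(** The variation of constants formula: solutions continuing [x] from time [s]
are the fixed points of this operator, which is monotone because [a >= 0] and
preserves the bound [M] because each agent moves towards values of others. *)
Let step (y : V -> R -> R) m t :=
  if t <= s then x m t else
  (E m t)^-1 * (E m s * x m s + (prim (inflow y m) t - prim (inflow y m) s)).

Let step_admissible y : admissible y -> admissible (step y).
Proof.
move=> ady m; split.
  apply: measurable_fun_ifT => //.
    exact: measurable_fun_ler.
  apply: measurable_funM; first exact: ifactorV_meas.
  apply: measurable_funD => //; apply: measurable_funB => //.
  by apply: measurable_prim; exact: inflow_int.
move=> t; rewrite /step; case: (leP t s) => // st.
rewrite normrM gtr0_norm ?invr_gt0// ler_pdivrMl//.
rewrite (le_trans (ler_normD _ _))//.
have := prim_le_ifactor (ltW st) (inflow_int m ady)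
  (fun t => inflow_le m t ady).
have Esx : `|E m s * x m s| <= M * E m s.
  by rewrite normrM gtr0_norm// mulrC ler_wpM2r// ltW.
move=> /(lerD Esx)/le_trans; apply.
by rewrite -mulrDr subrKC mulrC.
Qed.

Let step_le y z : admissible y -> admissible z ->
  (forall m t, y m t <= z m t) -> forall m t, step y m t <= step z m t.
Proof.
move=> ady adz yz m t; rewrite /step; case: (leP t s) => // st.
rewrite ler_pM2l ?invr_gt0// lerD2l.
apply: prim_le (ltW st) _; [exact: inflow_int|exact: inflow_int|].
move=> r _; rewrite ler_pM2l//; apply: ler_sum => l _.
exact: ler_wpM2l.
Qed.

(** Starting from the constant upper bound, the iterates decrease, so they
converge with no smallness condition and on all times at once. *)
Let upper n := iter n step (fun _ _ => M).

Let upper_admissible n : admissible (upper n).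
Proof.
elim: n => [|n ih] /=; last exact: step_admissible.
move=> m; split => // t; rewrite ger0_norm//.
exact: le_trans (normr_ge0 _) (x_le m t).
Qed.

Let upper_le n m t : upper n.+1 m t <= upper n m t.
Proof.
elim: n m t => [|n ih] m t.
  exact: le_trans (ler_norm _) ((upper_admissible 1 m).2 t).
exact: (step_le (upper_admissible n.+1) (upper_admissible n)).
Qed.

Let y m t := limn (fun n => upper n m t).

Let upper_cvg m t : upper n m t @[n --> \oo] --> y m t.
Proof.
apply: nonincreasing_is_cvgn.
  by apply/nonincreasing_seqP => n; exact: upper_le.
exists (- M) => _ [n _ <-]; have := (upper_admissible n m).2 t.
by rewrite ler_norml => /andP[].
Qed.

Let y_admissible : admissible y.
Proof.
move=> m; split.
  apply: (@measurable_fun_cvg _ _ _ _ (fun n => upper n m)).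
    by move=> n; exact: (upper_admissible n m).1.
  by move=> t _; exact: upper_cvg.
move=> t; rewrite ler_norml; apply/andP; split.
  apply: limr_ge; first by apply: cvgP; exact: upper_cvg.
  apply: nearW => n; have := (upper_admissible n m).2 t.
  by rewrite ler_norml => /andP[].
apply: limr_le; first by apply: cvgP; exact: upper_cvg.
apply: nearW => n; have := (upper_admissible n m).2 t.
by rewrite ler_norml => /andP[].
Qed.

(** Dominated convergence lets [step] commute with the limit. *)
Let y_fix m t : y m t = step y m t.
Proof.
have H : upper n.+1 m t @[n --> \oo] --> y m t.
  by have := @upper_cvg m t; rewrite -(cvg_shiftS (fun n => upper n m t)).
apply: cvg_unique H _ => //.
rewrite /= /step; case: (leP t s) => [|st]; first by move=> _; exact: cvg_cst.
have prim_cvg r :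
    prim (inflow (upper n) m) r @[n --> \oo] --> prim (inflow y m) r.
  apply: (@prim_dominated_cvg _ _ _ (fun t => M * (E m t * alpha m t))).
  - by move=> n; exact: inflow_meas.
  - exact: inflow_meas.
  - apply: (left_integrable_dominated (Ealpha_int m)).
      apply: measurable_funM => //.
      exact: left_integrable_measurable.
    by move=> b; exists `|M| => u _; rewrite normrM.
  - by move=> n u; exact: inflow_le.
  - move=> u; apply: cvgMr; apply: cvg_big => [|l _].
      exact: add_continuous.
    by apply: cvgMr; exact: upper_cvg.
by apply: cvgMr; apply: cvgD; [exact: cvg_cst|exact: cvgB].
Qed.

(** The values of [x] are prescribed on all of [(-oo, s]], so that delayed
values make sense however long the delays are. *)
Theorem delay_system_solution : exists y : V -> R -> R,
  [/\ forall m t, t <= s -> y m t = x m t,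
      forall m b, absolutely_continuous_on s b (y m) &
      forall m, {ae mu, forall t : R, s < t ->
        is_derive t 1 (y m) (consensus_rhs a h y m t)}].
Proof.
exists y; split.
- by move=> m t ts; rewrite y_fix /step ts.
- move=> m b.
  have [sb|bs] := leP s b; last first.
    move=> e e0; exists 1 => // n u v uv _ _; rewrite big1// => k _.
    by have [? ? ?] := uv k; lra.
  apply: (@eq_ac _ (fun t => (E m t)^-1 *
     (E m s * x m s + (prim (inflow y m) t - prim (inflow y m) s)))).
    move=> t /andP[+ _]; rewrite le_eqVlt => /predU1P[<-|st].
      rewrite subrr addr0 mulrA mulVf ?gt_eqF// mul1r.
      by rewrite [RHS]y_fix /step lexx.
    by rewrite [RHS]y_fix /step leNgt st.
  apply: acM => //; first exact: ifactorV_ac.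
  apply: acD; first exact: ac_cst.
  by apply: acB; [apply: ac_prim; exact: inflow_int|exact: ac_cst].
- move=> m.
  apply: ae_imply2 (ifactorV_derive a_int m)
    (is_derive_prim (inflow_int m y_admissible)).
  move=> t dE dI st.
  have yE : \forall r \near t, (E m r)^-1 *
     (E m s * x m s + (prim (inflow y m) r - prim (inflow y m) s)) = y m r.
    near=> r.
    have sr : s < r by near: r; exact: lt_nbhsr.
    by rewrite [RHS]y_fix /step leNgt sr.
  apply: (near_eq_is_derive yE).
  have := is_derive_mul dE (is_derive_add (is_derive_cst (E m s * x m s) t 1)
    (is_derive_sub dI (is_derive_cst (prim (inflow y m) s) t 1))).
  move=> /is_derive_eq; apply; rewrite /= add0r subr0 mulrN [X in _ - X]mulrCA.
  have := nbhs_singleton yE; rewrite /= [X in _ - X]mulrA => ->.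
  rewrite /inflow mulrA mulVf ?gt_eqF// mul1r /consensus_rhs /damping.
  rewrite mulr_sumr -sumrB; apply: eq_bigr => l _.
  by rewrite mulrBr [y m t * _]mulrC.
Unshelve. all: by end_near. Qed.

End existence.

(** * The effect of a disturbance is bounded by its integral *)

Section comparison.
Context {R : realType} {V : finType}.
Notation mu := (@lebesgue_measure R).
Variables (hbar s : R) (a h : V -> V -> R -> R) (g : R -> R).
Hypothesis a_ge0 : forall k l t, 0 <= a k l t.
Hypothesis a_int : forall k l, left_integrable (a k l).
Hypothesis h_bound : forall k l t, 0 <= h k l t <= hbar.
Hypothesis g_ge0 : forall t, 0 <= g t.
Hypothesis g_int : left_integrable g.

Let G t := prim g t - prim g s.

Let G_nd u v : u <= v -> G u <= G v.
Proof.
move=> uv; rewrite /G lerD2r -subr_ge0 primB//.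
by apply: Rintegral_ge0 => t _.
Qed.

Section one_sided.
Variables (z f : V -> R -> R).
Hypothesis z_history : forall m t, s - hbar <= t <= s -> z m t = 0.
Hypothesis z_ac : forall m b, s <= b -> absolutely_continuous_on s b (z m).
Hypothesis z_ode : forall m, {ae mu, forall t : R, s < t ->
  is_derive t 1 (z m) (consensus_rhs a h z m t + f m t)}.
Hypothesis f_le : forall m t, f m t <= g t.

Let bounded_on T B := forall m t, s <= t <= T -> z m t - G t <= B.

(** Up to time [T] every delayed value is at most the present value of [B + G],
because [G] is nondecreasing; hence the integrating factor times [B + G - z m]
is nondecreasing. Its value at [s] is [B] times the factor, so [B + G - z m]
stays above a fixed fraction of [B]. *)
Let improve m T B t : 0 <= B -> bounded_on T B -> s <= t <= T ->
  z m t - G t <= (1 - ifactor a m s / ifactor a m T) * B.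
Proof.
move=> B0 zB /andP[st tT].
pose w r := ifactor a m r * (B + G r - z m r).
have : w s <= w t.
  apply: ac_ge0_derive_le => //.
    apply: acM => //; first exact: ifactor_ac.
    apply: acB; last exact: z_ac.
    apply: acD; first exact: ac_cst.
    by apply: acB; [exact: ac_prim|exact: ac_cst].
  apply: ae_imply2 (ifactor_derive a_int m)
    (ae_imply2 (fun r dG dz => conj dG dz) (is_derive_prim g_int) (z_ode m)).
  move=> r dE [dg dz] /andP[sr rt].
  have dGr := is_derive_sub dg (is_derive_cst (prim g s) r 1).
  have := is_derive_mul dE (is_derive_sub
    (is_derive_add (is_derive_cst B r 1) dGr) (dz sr)).
  set dw := (_ + _) => dwr; exists dw; first exact: dwr.
  rewrite /dw /= -/(G r) subr0 add0r mulrCA -mulrDr.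
  apply: mulr_ge0; first exact/ltW/ifactor_gt0.
  have -> : (B + G r - z m r) * damping a m r = consensus_rhs a h z m r +
      \sum_(l | l != m) a m l r * (B + G r - z l (r - h m l r)).
    rewrite /consensus_rhs /damping mulr_sumr -big_split/=.
    apply: eq_bigr => l _.
    move: (G r) (z m r) (a m l r) (z l _) => *; ring.
  have cancel (p q k l : R) : p - (q + k) + (q + l) = (p - k) + l by ring.
  rewrite cancel.
  apply: addr_ge0; first by rewrite subr_ge0.
  apply: sumr_ge0 => l _; apply: mulr_ge0 => //.
  have /andP[h0 hh] := h_bound m l r.
  have [sh|hs] := leP s (r - h m l r).
    have := zB l (r - h m l r); rewrite sh/= => /(_ ltac:(lra)).
    have /G_nd : r - h m l r <= r by lra.
    move: (G _) (G r) (z l _) => *; lra.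
  rewrite z_history; last by apply/andP; split; lra.
  have := G_nd (ltW sr); rewrite {1}/G subrr.
  move: (G r) => *; lra.
rewrite /w /G subrr addr0 -/(G t) z_history; last first.
  by have /andP[h0 hh] := h_bound m m s; apply/andP; split; lra.
rewrite subr0 mulrBl mul1r mulrAC.
have Et := ifactor_gt0 a m t; have ET := ifactor_gt0 a m T.
have := ifactor_nd a_ge0 a_int m tT.
have Es := ifactor_gt0 a m s.
move: (G t) (z m t) Et ET Es.
move: (ifactor a m s) (ifactor a m t) (ifactor a m T).
move=> Es Et ET Gt zt Et0 ET0 Es0 EtT H.
have : Es * B / ET <= B + Gt - zt; last by lra.
apply: (@le_trans _ _ (Es * B / Et)).
  by rewrite ler_wpM2l ?lef_pV2//; apply: mulr_ge0 => //; exact: ltW.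
by rewrite ler_pdivrMr// [leRHS]mulrC.
Qed.

(** The gain in the previous lemma is by a factor [q < 1] common to all agents,
so any initial bound can be improved to [q ^+ n * B] for every [n]. *)
Lemma one_sided_bound m t : s <= t -> z m t <= G t.
Proof.
move=> st.
pose q := \big[Num.max/0]_k (1 - ifactor a k s / ifactor a k t).
have q0 : 0 <= q by exact: bigmax_ge_id.
have q1 : q < 1.
  apply: bigmax_lt => // k _.
  by rewrite gtrBl divr_gt0// ifactor_gt0.
have qk k : 1 - ifactor a k s / ifactor a k t <= q by exact: le_bigmax.
have zG_ac k : absolutely_continuous_on s t (fun r => z k r - G r).
  apply: acB; first exact: z_ac.
  by apply: acB; [exact: ac_prim|exact: ac_cst].
have /choice[M zM] k := ac_bounded st (zG_ac k).
pose B := \sum_k `|M k|.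
have zB : bounded_on t B.
  move=> k r str; rewrite (le_trans (ler_norm _))// (le_trans (zM k r str))//.
  rewrite (le_trans (ler_norm _))// /B (bigD1 k)//= lerDl.
  exact: sumr_ge0.
have zqB n : bounded_on t (q ^+ n * B).
  elim: n => [|n ih]; first by rewrite expr0 mul1r.
  have qB0 : 0 <= q ^+ n * B.
    by rewrite mulr_ge0 ?exprn_ge0// /B; exact: sumr_ge0.
  move=> k r str; rewrite (le_trans (improve k qB0 ih str))//.
  by rewrite exprS -mulrA; exact: ler_wpM2r.
rewrite -subr_le0.
have cv : q ^+ n * B @[n --> \oo] --> 0.
  rewrite -(mul0r B); apply: cvgMl; apply: cvg_expr.
  by rewrite ger0_norm.
rewrite -(cvg_lim _ cv)//; apply: limr_ge; first exact: cvgP cv.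
by apply: nearW => n; apply: zqB; rewrite st lexx.
Qed.
End one_sided.

Theorem comparison (z f : V -> R -> R) :
    (forall m t, s - hbar <= t <= s -> z m t = 0) ->
    (forall m b, s <= b -> absolutely_continuous_on s b (z m)) ->
    (forall m, {ae mu, forall t : R, s < t ->
       is_derive t 1 (z m) (consensus_rhs a h z m t + f m t)}) ->
    (forall m t, `|f m t| <= g t) ->
  forall m t, s <= t -> `|z m t| <= prim g t - prim g s.
Proof.
move=> z0 zac zode fg m t st; rewrite ler_norml lerNl; apply/andP; split.
- apply: (@one_sided_bound (fun m t => - z m t) (fun m t => - f m t)) => //.
  + by move=> k r kr; rewrite z0// oppr0.
  + by move=> k b sb; apply: acN; exact: zac.
  + move=> k; apply: ae_imply (zode k) => r dz sr.
    have := is_derive_opp (dz sr) => /is_derive_eq; apply.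
    rewrite opprD; congr (_ + _); rewrite /consensus_rhs -sumrN.
    by apply: eq_bigr => l _; rewrite -mulrN opprD.
  + by move=> k r; rewrite (le_trans (ler_norm _))// normrN.
- apply: (@one_sided_bound z f) => //.
  by move=> k r; rewrite (le_trans (ler_norm _)).
Qed.

End comparison.

(** * Borel versions of Lebesgue measurable data *)

Section borel_version.
Context {R : realType}.
Notation mu := (@lebesgue_measure R).
Notation cmu := (@completed_lebesgue_measure R).
Implicit Types (f g : R -> R) (D N : set R).

Lemma lebesgue_set_decomp (A : set R) : measurable (A : set (lebesgueType R)) ->
  exists B N : set R, [/\ measurable B, mu.-negligible N & A = B `|` N].
Proof.
have := @completed_caratheodory_measurable R.
rewrite g_sigma_completed_algebra_genE => E mA.
have : (completed_algebra_gen mu) A by rewrite E.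
by move=> [B mB [N nN <-]]; exists B, N.
Qed.

(** Each sublevel set of [f] at a rational height is Borel up to a null set. One
Borel null set [N] serves the countably many rational heights, and off [N] the
other sublevel sets are unions of these. *)
Lemma lebesgue_borel_version D f :
    measurable D -> lebesgue_measurable_fun D f ->
  exists N, [/\ measurable N, mu N = 0%E &
    measurable_fun setT (f \_ (D `\` N))].
Proof.
move=> mD mf.
have mD' : measurable (D : set (lebesgueType R)).
  by have := @sub_caratheodory _ _ _ (@wlength R idfun); apply.
have dec (q : rat) : exists BN : set R * set R,
    [/\ measurable BN.1, mu.-negligible BN.2 &
        D `&` [set x | f x < ratr q] = BN.1 `|` BN.2].
  have /lebesgue_set_decomp[B [N [mB nN E]]] :
      measurable (D `&` [set x | f x < ratr q] : set (lebesgueType R)).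
    have := mf mD' `]-oo, ratr q[%classic (measurable_itv _).
    by congr measurable; apply/seteqP; split => x /=; rewrite in_itv.
  by exists (B, N).
have [BN HBN] := choice dec.
pose N0 := \bigcup_n (BN (odflt 0 (unpickle n))).2.
have [N [mN N_0 N0N]] : mu.-negligible N0.
  by apply: negligible_bigcup => n; have [] := HBN (odflt 0 (unpickle n)).
exists N; split => //.
have lowE (q : rat) : (D `&` [set x | f x < ratr q]) `\` N = (BN q).1 `\` N.
  have [_ _ ->] := HBN q; apply/seteqP; split => x [].
    move=> [//|Nx] nNx; exfalso; apply: nNx; apply: N0N.
    by exists (pickle q) => //; rewrite pickleK.
  by move=> Bx nNx; split => //; left.
have mlow (r : R) : measurable ((D `&` [set x | f x < r]) `\` N).
  have -> : (D `&` [set x | f x < r]) `\` N =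
      \bigcup_(q in [set q : rat | ratr q < r]) ((BN q).1 `\` N).
    apply/seteqP; split => [x [[Dx fx] Nx]|x [q /= qr]].
      have [q] := rat_in_itvoo fx; rewrite in_itv/= => /andP[fq qr].
      exists q => //; have : ((D `&` [set x | f x < ratr q]) `\` N) x by split.
      by rewrite lowE.
    move=> BNx; have : ((D `&` [set x | f x < ratr q]) `\` N) x by rewrite lowE.
    by move=> -[[Dx fx] Nx]; split => //; split => //; exact: lt_trans fx qr.
  rewrite bigcup_mkcond; apply: bigcupT_measurable_rat => q.
  by case: ifP => // _; apply: measurableD => //; have [] := HBN q.
apply: (measurability _ (RGenInftyO.measurableE R)) => _ [_ [r ->] <-].
rewrite setTI.
have -> : (f \_ (D `\` N)) @^-1` `]-oo, r[ =
    ((D `&` [set x | f x < r]) `\` N) `|`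
    (if 0 < r then ~` (D `\` N) else set0).
  apply/seteqP; split => x /=; rewrite in_itv/= patchE;
    have [xDN|xDN] := pselect ((D `\` N) x).
  - by rewrite mem_set// => fx; left; case: xDN.
  - by rewrite memNset// => r0; right; rewrite r0.
  - by rewrite mem_set// => -[[[]//]|]; case: ifP.
  - rewrite memNset// => -[[[Dx _] Nx]|]; first by exfalso; exact: xDN.
    by case: ifP.
apply: measurableU => //; case: ifP => // _.
by apply: measurableC; exact: measurableD.
Qed.

(** The Borel Lebesgue measure is the image of the completed one under the
identity, so the two integrals of a Borel function agree. *)
Lemma borel_version_integrable D N f : measurable D -> measurable N ->
    measurable_fun setT (f \_ (D `\` N)) -> lebesgue_integrable D f ->
  mu.-integrable setT (EFin \o (f \_ (D `\` N))).
Proof.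
move=> mD mN mg /integrableP[mf foo].
have mid : measurable_fun setT (id : lebesgueType R -> measurableTypeR R).
  move=> _ A mA; rewrite setTI.
  by have := @sub_caratheodory _ _ _ (@wlength R idfun); apply.
have mD' : measurable (D : set (lebesgueType R)).
  by rewrite -[D]setTI; exact: mid.
apply/integrableP; split; first exact/measurable_EFinP.
have mg' : measurable_fun setT (fun x => `|(EFin \o f \_ (D `\` N)) x|%E).
  by apply/measurable_EFinP/measurableT_comp.
have -> : (\int[mu]_x `|(EFin \o f \_ (D `\` N)) x| =
   \int[pushforward cmu (id : lebesgueType R -> measurableTypeR R)]_x
     `|(EFin \o f \_ (D `\` N)) x|)%E.
  exact: eq_measure_integral.
rewrite (ge0_integral_pushforward mid)//.
apply: le_lt_trans foo.
rewrite [leRHS]integral_mkcond.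
apply: ge0_le_integral.
- exact: measurableT.
- by move=> x _; exact: abse_ge0.
- exact: (measurableT_comp mg' mid).
- by apply/(measurable_restrictT _ mD'); exact: measurableT_comp.
- move=> x _ /=; rewrite !patchE; have [Dx|Dx] := pselect (D x).
    rewrite [in leRHS]mem_set//; case: ifP => // _.
    by rewrite normr0 lee_fin.
  rewrite [in leRHS]memNset// memNset ?normr0//.
  by move=> [].
Qed.

End borel_version.

Section borel_coefficients.
Context {R : realType}.
Notation mu := (@lebesgue_measure R).
Implicit Types (f : R -> R).

(** The second clause makes every sign or size condition that holds for [f] on
nonnegative times and is compatible with the value 0 hold for [f'] at all
times, not only almost everywhere. *)
Definition borel_version_of f (f' : R -> R) :=
  {ae mu, forall t : R, 0 <= t -> f' t = f t} /\
  forall t, f' t = 0 \/ (0 <= t /\ f' t = f t).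

Lemma restrict_version f N : measurable N -> mu N = 0%E ->
  borel_version_of f (f \_ (`[0, +oo[ `\` N)).
Proof.
move=> mN N0; split.
  exists N; split => // t /= H; apply: contrapT => Nt; apply: H => t0.
  by rewrite patchE mem_set//; split => //=; rewrite in_itv/= t0.
move=> t; have [DN|nDN] := pselect ((`[0, +oo[ `\` N) t).
  right; rewrite patchE mem_set//; split => //.
  by case: DN; rewrite /= in_itv/= andbT.
by left; rewrite patchE memNset.
Qed.

Lemma borel_version_measurable f : lebesgue_measurable_fun `[0, +oo[ f ->
  exists2 f', measurable_fun setT f' & borel_version_of f f'.
Proof.
move=> mf.
have mD : measurable (`[0, +oo[%classic : set R) by exact: measurable_itv.
have [N [mN N0 mg]] := lebesgue_borel_version mD mf.
by exists (f \_ (`[0, +oo[ `\` N)) => //; exact: restrict_version.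
Qed.

Lemma borel_version_integrableT f : lebesgue_integrable `[0, +oo[ f ->
  exists2 f', mu.-integrable setT (EFin \o f') & borel_version_of f f'.
Proof.
move=> iF.
have mD : measurable (`[0, +oo[%classic : set R) by exact: measurable_itv.
have mf : lebesgue_measurable_fun `[0, +oo[ f.
  by move/integrableP : (iF) => [/measurable_EFinP].
have [N [mN N0 mg]] := lebesgue_borel_version mD mf.
exists (f \_ (`[0, +oo[ `\` N)); last exact: restrict_version.
exact: borel_version_integrable.
Qed.

Lemma borel_version_left_integrable f : locally_lebesgue_integrable f ->
  exists2 f', left_integrable f' & borel_version_of f f'.
Proof.
move=> iF.
have mD : measurable (`[0, +oo[%classic : set R) by exact: measurable_itv.
have mf : lebesgue_measurable_fun `[0, +oo[ f.
  have -> : `[0, +oo[%classic = \bigcup_n `[0, n%:R : R]%classic.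
    apply/seteqP; split => x /=; rewrite in_itv/=.
      move=> /andP[x0 _]; exists (Num.truncn x).+1 => //=.
      by rewrite in_itv/= x0 ltW// truncnS_gt.
    by move=> [n _]; rewrite /= in_itv/= => /andP[->].
  apply/measurable_fun_bigcup => n.
    have := @sub_caratheodory _ _ _ (@wlength R idfun); apply.
    exact: measurable_itv.
  by have /integrableP[/measurable_EFinP] := iF n%:R (ler0n _ _).
have [N [mN N0 mg]] := lebesgue_borel_version mD mf.
exists (f \_ (`[0, +oo[ `\` N)); last exact: restrict_version.
move=> b; pose b' := Num.max b 0.
have E : (f \_ (`[0, +oo[ `\` N)) \_ `]-oo, b'] = f \_ (`[0, b'] `\` N).
  apply/funext => t; rewrite !patchE.
  have -> : (t \in `[0, b'] `\` N) =
      (t \in `]-oo, b']%classic) && (t \in `[0, +oo[ `\` N).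
    apply/idP/andP => [|[]]; rewrite !inE/= !in_itv/= ?andbT.
      by move=> [/andP[t0 tb] Nt].
    by move=> tb [t0 Nt]; rewrite t0.
  by case: ifP => //=.
have ib : mu.-integrable setT (EFin \o f \_ (`[0, b'] `\` N)).
  apply: borel_version_integrable => //.
    rewrite -E; apply/(measurable_restrictT _ _).1; [exact: measurable_itv|].
    exact: measurable_funTS.
  by apply: iF; rewrite le_max lexx orbT.
have ib' : mu.-integrable `]-oo, b'] (EFin \o f \_ (`[0, +oo[ `\` N)).
  rewrite -[X in mu.-integrable X _]setTI; apply/integrable_restrict => //.
  by rewrite restrict_EFin E.
apply: integrableS ib' => //; apply: subset_itvl.
by rewrite bnd_simp le_max lexx.
Qed.

End borel_coefficients.

(** * Consensus of the disturbed system *)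

Section tails.
Context {R : realType}.
Notation mu := (@lebesgue_measure R).

Lemma integrable_left_integrable (g : R -> R) :
  mu.-integrable setT (EFin \o g) -> left_integrable g.
Proof. by move=> ig b; apply: integrableS ig. Qed.

Lemma prim_tail (g : R -> R) (e : R) : mu.-integrable setT (EFin \o g) ->
    (forall t, 0 <= g t) -> 0 < e ->
  exists S, forall s t, S <= s -> s <= t -> prim g t - prim g s <= e.
Proof.
move=> ig g0 e0; have lg := integrable_left_integrable ig.
have nd u v : u <= v -> prim g u <= prim g v.
  by move=> uv; rewrite -subr_ge0 primB//; apply: Rintegral_ge0 => t _.
have ub : has_ubound (range (prim g)).
  exists (\int[mu]_x g x)%R => _ [t _ <-].
  rewrite primE; apply: fine_le.
  - exact: integrable_fin_num.
  - exact: integrable_fin_num.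
  - apply: ge0_subset_integral => //; first by have /integrableP[] := ig.
    by move=> x _; rewrite lee_fin.
have hs : has_sup (range (prim g)) by split => //; exists (prim g 0), 0.
have [_ [S _ <-] HS] := sup_adherent e0 hs.
exists S => s t Ss st.
have : prim g t <= sup (range (prim g)) by apply: ub_le_sup => //; exists t.
have := nd _ _ Ss; lra.
Qed.

Lemma ae_neq (c : R) : {ae mu, forall t : R, t != c}.
Proof.
exists [set c]; split => //; first exact: lebesgue_measure_set1.
by move=> t /= /negP; rewrite negbK => /eqP.
Qed.

End tails.

(** Freezing a trajectory before [a] and after [b] turns its restriction to
[[a, b]] into a bounded Borel history defined at all times. *)
Lemma clamp_continuous (R : realType) (f : R -> R) (a b : R) : a <= b ->
    absolutely_continuous_on a b f ->
  continuous (fun t => f (Num.max a (Num.min t b))).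
Proof.
move=> ab fac t; apply/cvgrPdist_lt => e e0.
have [d d0 H] := ac_uniformly_continuous fac e0.
exists d => //= u /= ud; apply: H.
- by rewrite ge_max le_max lexx ab ge_min lexx orbT.
- by rewrite ge_max le_max lexx ab ge_min lexx orbT.
- apply: le_lt_trans ud; rewrite !maxEle !minEle.
  case: (leP u b) => ub; case: (leP t b) => tb;
  repeat (case: ifP => ?);
  rewrite ler_norml; apply/andP; split;
  have := ler_norm (t - u); have := ler_norm (u - t); rewrite distrC; lra.
Qed.

Lemma consensus_rhsB (R : realType) (V : finType) (a h : V -> V -> R -> R)
    (x y : V -> R -> R) m t :
  consensus_rhs a h (fun k r => x k r - y k r) m t =
  consensus_rhs a h x m t - consensus_rhs a h y m t.
Proof.
rewrite /consensus_rhs -sumrB; apply: eq_bigr => l _.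
by rewrite -mulrBr; congr (_ * _); ring.
Qed.

Section restart.
Context {R : realType} {V : finType}.
Notation mu := (@lebesgue_measure R).
Variables (hbar : R) (a h a' h' : V -> V -> R -> R).
Hypothesis hbar_ge0 : 0 <= hbar.
Hypothesis a'_ge0 : forall k l t, 0 <= a' k l t.
Hypothesis a'_int : forall k l, left_integrable (a' k l).
Hypothesis h'_bound : forall k l t, 0 <= h' k l t <= hbar.
Hypothesis h'_meas : forall k l, measurable_fun setT (h' k l).
Hypothesis a'E : forall k l,
  {ae mu, forall t : R, 0 <= t -> a' k l t = a k l t}.
Hypothesis h'E : forall k l,
  {ae mu, forall t : R, 0 <= t -> h' k l t = h k l t}.

Let rhsE : {ae mu, forall t : R, 0 <= t -> forall x m,
  consensus_rhs a' h' x m t = consensus_rhs a h x m t}.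
Proof.
have : {ae mu, forall t : R, forall kl : V * V, 0 <= t ->
    a' kl.1 kl.2 t = a kl.1 kl.2 t /\ h' kl.1 kl.2 t = h kl.1 kl.2 t}.
  apply: filter_forall => -[k l].
  apply: ae_imply2 (a'E k l) (h'E k l) => t Ha Hh t0.
  by split; [exact: Ha|exact: Hh].
apply: ae_imply => t H t0 x m; apply: eq_bigr => l _.
by have [/= -> ->] := H (m, l) t0.
Qed.

Variables (f : V -> R -> R) (g : R -> R).
Hypothesis g_ge0 : forall t, 0 <= g t.
Hypothesis g_int : left_integrable g.
Hypothesis f_le : forall m, {ae mu, forall t : R, 0 <= t -> `|f m t| <= g t}.

Variables (ts s : R) (x0 : V -> R) (phi x : V -> R -> R).
Hypothesis ts_ge0 : 0 <= ts.
Hypothesis ts_s : ts + hbar <= s.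
Hypothesis x_sol : is_solution hbar
  (fun x m t => consensus_rhs a h x m t + f m t) ts x0 phi x.

(** Switch the disturbance off at a time [s] whose whole delay window lies after
[ts]: the undisturbed solution that continues the disturbed one has a
continuous history, and departs from it by at most what the disturbance
accumulates after [s]. *)
Lemma undisturbed_shadow : exists (psi y : V -> R -> R),
  [/\ bounded_borel_history hbar psi,
      is_solution hbar (consensus_rhs a h) s (x ^~ s) psi y &
      forall m t, s <= t -> `|x m t - y m t| <= prim g t - prim g s].
Proof.
have tss : ts <= s by move: hbar_ge0 ts_s; lra.
have s0 : 0 <= s by move: ts_ge0; lra.
have history_after_ts t : s - hbar <= t -> ts <= t by move: ts_s; lra.
have xac m b : ts <= b -> absolutely_continuous_on ts b (x m).
  exact: (solution_ac x_sol).
have /choice[M xM] m := ac_bounded tss (xac m s tss).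
pose xs m t := x m (Num.max ts (Num.min t s)).
have xs_cont m : continuous (xs m) := clamp_continuous tss (xac m s tss).
have xs_meas m : measurable_fun setT (xs m) by exact: continuous_measurable_fun.
pose B := \sum_k `|M k|.
have xsB m t : `|xs m t| <= B.
  apply: (le_trans (xM m _ _)).
    by rewrite le_max lexx ge_max tss ge_min lexx orbT.
  rewrite (le_trans (ler_norm _))// /B (bigD1 m)//= lerDl.
  exact: sumr_ge0.
have xsE m t : ts <= t -> t <= s -> xs m t = x m t.
  by move=> tt ts'; rewrite /xs (min_idPl ts') (max_idPr tt).
have [y [y_hist y_ac y_ode]] :=
  delay_system_solution s a'_ge0 a'_int h'_meas xs_meas xsB.
exists (fun m r => xs m (s + r)), y; split.
- move=> m; split.
    apply: measurable_funTS; apply: measurableT_comp => //.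
    exact: measurable_funD.
  exists B; split; first exact: num_real.
  by move=> C BC r _ /=; rewrite (le_trans (xsB _ _))// ltW.
- split.
  + by move=> m; rewrite y_hist// xsE.
  + move=> m r /andP[_ r0]; rewrite y_hist//; lra.
  + by move=> m b _; exact: y_ac.
  + move=> m; apply: ae_imply2 (y_ode m)
      (ae_imply2 (fun t => @conj _ _) rhsE (ae_neq s)).
    move=> t dy [E tNs] st; rewrite -E; last by lra.
    by apply: dy; rewrite lt_neqAle eq_sym tNs.
pose z m t := x m t - y m t.
(* The bound by g is only known almost everywhere, so the disturbance is
   truncated to make it hold at every time. *)
pose ft m t := if 0 <= t then Num.max (- g t) (Num.min (f m t) (g t)) else 0.
apply: (@comparison _ _ hbar s a' h' g _ _ _ _ _ z ft) => //.
- move=> m t /andP[st ts'].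
  by rewrite /z y_hist// xsE ?subrr//; exact: history_after_ts.
- move=> m b sb; apply: acB => //.
  by apply: (ac_sub tss (lexx b)); apply: xac; lra.
- move=> m.
  apply: ae_imply2
    (ae_imply2 (fun t => @conj _ _) (y_ode m) (solution_ode x_sol m))
    (ae_imply2 (fun t => @conj _ _) rhsE (f_le m)).
  move=> t [dy dx] [E fg] st.
  have t0 : 0 <= t by lra.
  have tst : ts <= t by lra.
  have := is_derive_sub (dx tst) (dy st) => /is_derive_eq; apply.
  rewrite /ft t0 consensus_rhsB !E// addrAC; congr (_ + _).
  move: (fg t0); rewrite ler_norml => /andP[f1 f2].
  by rewrite (min_idPl f2) (max_idPr f1).
- move=> m t; rewrite /ft; case: ifP => // _; last by rewrite normr0.
  rewrite ler_norml le_max lexx/= ge_max ge_min lexx orbT andbT.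
  by have := g_ge0 t; lra.
Qed.

End restart.

Theorem lemma5 (R : realType) (V : finType) (hbar : R)
    (a h : V -> V -> R -> R) (i j : V)
    (hbar_ge0 : 0 <= hbar)
    (a_ge0 : forall k l t, 0 <= t -> 0 <= a k l t)
    (a_loc_int : forall k l, locally_lebesgue_integrable (a k l))
    (h_bound : forall k l t, 0 <= t -> 0 <= h k l t <= hbar)
    (h_meas : forall k l, lebesgue_measurable_fun `[0, +oo[ (h k l))
    (undisturbed : establishes_consensus hbar (consensus_rhs a h) i j)
    (f : V -> R -> R)
    (f_L1 : forall m, lebesgue_integrable `[0, +oo[ (f m)) :
  establishes_consensus hbar
    (fun x m t => consensus_rhs a h x m t + f m t) i j.
Proof.
have /choice[a2 a2P] (kl : V * V) : exists a', left_integrable a' /\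
    borel_version_of (a kl.1 kl.2) a'.
  have [a' ? ?] := borel_version_left_integrable (a_loc_int kl.1 kl.2).
  by exists a'.
have /choice[h2 h2P] (kl : V * V) : exists h', measurable_fun setT h' /\
    borel_version_of (h kl.1 kl.2) h'.
  by have [h' ? ?] := borel_version_measurable (h_meas kl.1 kl.2); exists h'.
have /choice[f' f'P] m : exists f',
    lebesgue_measure.-integrable setT (EFin \o f') /\ borel_version_of (f m) f'.
  by have [f' ? ?] := borel_version_integrableT (f_L1 m); exists f'.
pose a' k l := a2 (k, l); pose h' k l := h2 (k, l).
have a'_ge0 k l t : 0 <= a' k l t.
  rewrite /a'; have [_ [_ /(_ t)[-> //|[t0 ->]]]] := a2P (k, l); exact: a_ge0.
have h'_bound k l t : 0 <= h' k l t <= hbar.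
  rewrite /h'; have [_ [_ /(_ t)[->|[t0 ->]]]] := h2P (k, l).
    by rewrite lexx.
  exact: h_bound.
pose g t := \sum_m `|f' m t|.
have g_ge0 t : 0 <= g t by exact: sumr_ge0.
have g_int : lebesgue_measure.-integrable setT (EFin \o g).
  have := @integrable_sum _ _ _ lebesgue_measure setT measurableT V
    (index_enum V) xpredT (fun m => abse \o (EFin \o f' m))
    (fun m _ => integrable_abse (f'P m).1).
  by apply: eq_integrable => // t _; rewrite /= sumEFin.
have f_le m : {ae lebesgue_measure, forall t : R, 0 <= t -> `|f m t| <= g t}.
  have [_ [fE _]] := f'P m; apply: ae_imply fE => t ft t0.
  rewrite -ft// /g (bigD1 m)//= lerDl; exact: sumr_ge0.
move=> ts x0 phi x ts0 phi_bb x_sol.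
(* For late s the disturbance left after s is small, and the undisturbed
   solution restarted at s brings both agents to one limit c. *)
have shadow e : 0 < e -> exists c S, forall t, S <= t ->
    `|x i t - c| <= e /\ `|x j t - c| <= e.
  move=> e0; have e2 : 0 < e / 2 by rewrite divr_gt0.
  have [S0 HS0] := prim_tail g_int g_ge0 e2.
  pose s := Num.max (ts + hbar) S0.
  have tss : ts + hbar <= s by rewrite le_max lexx.
  have Ss : S0 <= s by rewrite le_max lexx orbT.
  have [psi [y [psi_bb y_sol xy]]] := @undisturbed_shadow _ _ hbar a h a' h'
    hbar_ge0 a'_ge0 (fun k l => (a2P (k, l)).1) h'_bound
    (fun k l => (h2P (k, l)).1)
    (fun k l => (a2P (k, l)).2.1) (fun k l => (h2P (k, l)).2.1) f g g_ge0
    (integrable_left_integrable g_int) f_le ts s x0 phi x ts0 tss x_sol.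
  have s0 : 0 <= s by lra.
  have [c [yic yjc]] := undisturbed s _ _ _ s0 psi_bb y_sol.
  exists c.
  move/cvgrPdist_le : yic => /(_ _ e2)[Si [_ Hi]].
  move/cvgrPdist_le : yjc => /(_ _ e2)[Sj [_ Hj]].
  exists (Num.max s (Num.max Si Sj + 1)) => t; rewrite ge_max => /andP[st].
  rewrite -lerBrDr ge_max => /andP[Sit Sjt].
  have close m : `|c - y m t| <= e / 2 -> `|x m t - c| <= e.
    move=> cy; have xyt := le_trans (xy m t st) (HS0 _ _ Ss st).
    have := ler_distD (y m t) (x m t) c; rewrite [`|y m t - c|]distrC; lra.
  by split; apply: close; [apply: Hi|apply: Hj]; lra.
(* The approximate limits c depend on e, hence the passage through the Cauchy
   criterion. *)
have : cvg (x i t @[t --> +oo]).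
  apply/cauchy_cvgP/cauchy_exP => e e0.
  have e2 : 0 < e / 2 by rewrite divr_gt0.
  have [c [S HS]] := shadow _ e2; exists c.
  exists S; split; first exact: num_real.
  move=> t /ltW /HS[+ _]; rewrite /ball/= distrC; lra.
move=> /cvg_ex[/= L xiL]; exists L; split => //.
apply/cvgrPdist_le => e e0; have e4 : 0 < e / 4 by rewrite divr_gt0.
have [c [S HS]] := shadow _ e4.
move/cvgrPdist_le : xiL => /(_ _ e4)[Si [_ Hi]].
exists (Num.max S Si); split; first exact: num_real.
move=> t; rewrite gt_max => /andP[/ltW/HS[ic jc] /Hi Lit].
have := ler_distD (x i t) L (x j t); have := ler_distD c (x i t) (x j t).
rewrite [`|c - x j t|]distrC; lra.
Qed.
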